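(* Let $G=(S,\mathcal{F})$ be a local forest greedoid, $\mathcal{P}$ its set of paths and $f:\mathcal{P}\rightarrow\mathbb{R}$ a function that satisfies the following monotonicity constraints: (i) if $A,B\in\mathcal{P}$ and $A\subseteq B$ then $f(A)\le f(B)$; (ii) if $A,B,A\cup C,B\cup C\in\mathcal{P}$ (where $C\subseteq S$) and $f(A)\le f(B)$ then $f(A\cup C)\le f(B\cup C)$. Let $w(A)=\sum_{x\in A}f(P_x^A)$ for every $A\in\mathcal{F}$. Then the greedy algorithm gives a minimum base with respect to $w$, that is, a base $B^*$ with $w(B^* )\le w(B)$ for all bases $B$ of $G$.
   Context: Notation: $X+x=X\cup\{x\}$, $X-x=X\setminus\{x\}$, $X-Y=X\setminus Y$. A greedoid $G=(S,\mathcal{F})$ consists of a finite ground set $S$ and a family $\mathcal{F}\subseteq 2^S$ (the feasible sets) such that $\emptyset\in\mathcal{F}$, and whenever $X,Y\in\mathcal{F}$ with $|X|<|Y|$ there is $y\in Y-X$ with $X+y\in\mathcal{F}$. A base of $G$ is a feasible set of maximum size. $\mathcal{F}^{\vee}$ denotes the family of subfeasible sets, i.e. subsets of feasible sets. For $A\in\mathcal{F}$, the set of continuations is $\Gamma(A)=\{x\in S-A : A+x\in\mathcal{F}\}$. $G$ is a local forest greedoid if all of the following hold: - Local Union Property: if $A,B\in\mathcal{F}$ and $A\cup B\in\mathcal{F}^{\vee}$ then $A\cup B\in\mathcal{F}$; - Local Intersection Property: if $A,B\in\mathcal{F}$ and $A\cup B\in\mathcal{F}^{\vee}$ then $A\cap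 B\in\mathcal{F}$; - Local Forest Property: if $A, A+x, A+y, A\cup\{x,y\}, A\cup\{x,y,z\}\in\mathcal{F}$ then $A\cup\{x,z\}\in\mathcal{F}$ or $A\cup\{y,z\}\in\mathcal{F}$. Paths: for $A\in\mathcal{F}$ and $x\in A$, the $x$-path in $A$, denoted $P_x^A$, is the unique feasible set contained in $A$ and containing $x$ such that no proper feasible subset of it contains $x$ (existence and uniqueness follow from the Local Intersection Property). A path of $G$ is a set of the form $P_x^A$ with $A\in\mathcal{F}$, $x\in A$. Greedy algorithm (for minimizing $w$ over bases): start with $A=\emptyset$. While $\Gamma(A)\ne\emptyset$, choose an $x\in\Gamma(A)$ such that $w(A+x)\le w(A+y)$ for every $y\in\Gamma(A)$ (ties broken arbitrarily) and replace $A$ by $A+x$. When $\Gamma(A)=\emptyset$, stop and output $A$. The statement that the greedy algorithm gives a minimum base means that every legal run (any tie-breaking) outputs one. *)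

(* Defs.v *)
From HB Require Import structures.
From mathcomp Require Import all_boot all_order all_algebra.
From mathcomp Require Import reals.

Set Implicit Arguments.
Unset Strict Implicit.
Unset Printing Implicit Defensive.

Import Order.TTheory GRing.Theory Num.Theory.

Section Greedoids.
Variables (S : finType) (F : {set {set S}}).
Implicit Types (A B P : {set S}) (x y z : S).

Definition greedoid : Prop :=
  set0 \in F /\
  forall X Y, X \in F -> Y \in F -> #|X| < #|Y| ->
    exists2 y, y \in Y :\: X & y |: X \in F.

Definition is_base B : Prop :=
  B \in F /\ forall A, A \in F -> #|A| <= #|B|.

Definition subfeasible A : Prop := exists2 B, B \in F & A \subset B.

Definition continuations A : {set S} := [set x in ~: A | x |: A \in F].

Definition local_union : Prop :=
  forall A B, A \in F -> B \in F -> subfeasible (A :|: B) -> A :|: B \in F.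

Definition local_intersection : Prop :=
  forall A B, A \in F -> B \in F -> subfeasible (A :|: B) -> A :&: B \in F.

Definition local_forest : Prop :=
  forall A x y z,
    A \in F -> x |: A \in F -> y |: A \in F -> A :|: [set x; y] \in F ->
    A :|: [set x; y; z] \in F ->
    A :|: [set x; z] \in F \/ A :|: [set y; z] \in F.

Definition local_forest_greedoid : Prop :=
  [/\ greedoid, local_union, local_intersection & local_forest].

(* P is a feasible subset of A containing x, no proper feasible subset of P
   containing x. *)
Definition is_xpath A x P : bool :=
  (P \subset A) && minset [pred Q : {set S} | (Q \in F) && (x \in Q)] P.

(* The default set0 is irrelevant: by [xpathP] and [is_xpath_uniq], if A is
   feasible, x is in A and the local intersection property holds, then
   [xpath A x] is the unique P such that [is_xpath A x P]. *)
Definition xpath A x : {set S} := odflt set0 [pick P | is_xpath A x P].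

Definition is_path P : Prop :=
  exists A x, [/\ A \in F, x \in A & P = xpath A x].

Lemma xpathP A x : A \in F -> x \in A -> is_xpath A x (xpath A x).
Proof.
move=> FA xA; rewrite /xpath; case: pickP => // noP.
have [|P minP sPA] := @minset_exists _ [pred Q : {set S} | (Q \in F) && (x \in Q)] A.
  by rewrite /= FA.
by have := noP P; rewrite /is_xpath sPA minP.
Qed.

Lemma is_xpath_uniq A x P Q : local_intersection -> A \in F ->
  is_xpath A x P -> is_xpath A x Q -> P = Q.
Proof.
move=> LI FA /andP[sPA /minsetP[/andP[FP xP] minP]].
move=> /andP[sQA /minsetP[/andP[FQ xQ] minQ]].
have FI : P :&: Q \in F by apply: LI => //; exists A; rewrite // subUset sPA.
have pI : [pred Q : {set S} | (Q \in F) && (x \in Q)] (P :&: Q).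
  by rewrite /= FI inE xP.
by rewrite -(minP _ pI (subsetIl _ _)) -[in RHS](minQ _ pI (subsetIr _ _)).
Qed.

End Greedoids.

Section Greedy.
Local Open Scope ring_scope.
Variables (R : realType) (S : finType) (F : {set {set S}}).
Implicit Types (A B : {set S}).

(* Only the values of f on paths matter when A is feasible. *)
Definition path_weight (f : {set S} -> R) A : R :=
  \sum_(x in A) f (xpath F A x).

Variable w : {set S} -> R.

Definition greedy_step : rel {set S} := fun A B =>
  [exists x in continuations F A,
    [forall y in continuations F A, w (x |: A) <= w (y |: A)]
      && (B == x |: A)].

(* B is the output of some legal run, for some way of breaking ties. *)
Definition greedy_output B : bool :=
  connect greedy_step set0 B && (continuations F B == set0).

Definition is_minimum_base B : Prop :=
  is_base F B /\ forall B', is_base F B' -> w B <= w B'.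

(* Every run terminates: sizes strictly increase, and a run can get stuck only
   where it is meant to stop. *)
Lemma greedy_step_card A B : greedy_step A B -> #|B| = #|A|.+1.
Proof.
case/existsP=> x /and3P[]; rewrite !inE => /andP[xA _] _ /eqP->.
by rewrite cardsU1 xA.
Qed.

Lemma greedy_progress A : continuations F A != set0 ->
  exists B, greedy_step A B.
Proof.
case/set0Pn=> x0 x0A.
have [x xA xmin] := arg_minP (fun x => w (x |: A)) x0A.
exists (x |: A); apply/exists_inP; exists x => //; rewrite eqxx andbT.
by apply/forall_inP=> y; apply: xmin.
Qed.

End Greedy.

(* Main.v *)
(** Inside a base [B] the feasible sets are closed under union and intersection,
    and the local forest property makes every path of [B] a chain.  Let [B] be a
    minimum base containing the current greedy set [A], and let [x], not in [B],
    be the element chosen greedily.  Take [D] maximal with [A <= D <= B] and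
    [D], [D + x] feasible, and [y] in [B - D] with [D + y] feasible.  Then
    [D + x + y] is not feasible, so [x] and [y] behave like parallel edges above
    [D], and [B - y + x] is a base.  A path of [B] through [y] has the form
    [P_y + C] with [C] disjoint from [D], and it becomes [P_x + C] with the same
    [C].  As [f P_x <= f P_y] by the greedy choice and (i), condition (ii)
    shows that no term of the weight increases. *)
Require Import Defs.
From HB Require Import structures.
From mathcomp Require Import all_boot all_order all_algebra.
From mathcomp Require Import reals.

Set Implicit Arguments.
Unset Strict Implicit.
Unset Printing Implicit Defensive.

Import Order.TTheory GRing.Theory Num.Theory.
Local Open Scope ring_scope.

Section LocalForest.
Variables (S : finType) (F : {set {set S}}).
Hypothesis hF : local_forest_greedoid F.
Implicit Types (A B D E M P Q X Y Z : {set S}) (a b x y z u v : S).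

Let LI : local_intersection F. Proof. by case: hF. Qed.

(** * Augmentation, unions and intersections inside a feasible set *)

Lemma feasible0 : set0 \in F.
Proof. by case: hF => -[]. Qed.

Lemma augment X Y : X \in F -> Y \in F -> (#|X| < #|Y|)%N ->
  exists2 y, y \in Y :\: X & y |: X \in F.
Proof. by case: hF => -[_ h] _ _ _; apply: h. Qed.

Lemma feasibleU A B M : M \in F -> A \in F -> B \in F ->
  A \subset M -> B \subset M -> A :|: B \in F.
Proof.
move=> FM FA FB sA sB; case: hF => _ LU _ _; apply: LU => //.
by exists M; rewrite // subUset sA.
Qed.

Lemma feasibleI A B M : M \in F -> A \in F -> B \in F ->
  A \subset M -> B \subset M -> A :&: B \in F.
Proof.
by move=> FM FA FB sA sB; apply: LI => //; exists M; rewrite // subUset sA.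
Qed.

Lemma augment_card n X Y : X \in F -> Y \in F -> (#|X| <= n <= #|Y|)%N ->
  exists Z, [/\ Z \in F, X \subset Z, Z \subset X :|: Y & #|Z| = n].
Proof.
move=> FX FY; move: {2}(n - #|X|)%N (erefl (n - #|X|)%N) => m.
elim: m X FX => [|m IHm] X FX dm /andP[leXn lenY].
  by exists X; rewrite subxx subsetUl; split=> //; apply/eqP; rewrite eqn_leq leXn -subn_eq0 dm.
have ltXn : (#|X| < n)%N by rewrite -subn_gt0 dm.
have [y] := augment FX FY (leq_trans ltXn lenY).
rewrite inE => /andP[yX yY] FyX.
have cyX : #|y |: X| = #|X|.+1 by rewrite cardsU1 yX.
have [|//|Z [FZ sXZ sZ cZ]] := IHm _ FyX.
- by rewrite cyX subnS dm.
- by rewrite cyX ltXn.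
exists Z; split=> //; first exact: subset_trans (subsetUr _ _) sXZ.
apply: subset_trans sZ _; apply/subsetP=> u; rewrite !inE.
by case: eqP => [->|]; rewrite ?yY ?orbT.
Qed.

(** Growing [Q] by elements of [M] up to size [#|M|.-1] leaves out exactly one element of [M], and
    that element is outside [Q]. *)
Lemma removable_notin M Q : M \in F -> Q \in F -> Q \proper M ->
  exists2 b, b \in M :\: Q & M :\ b \in F.
Proof.
move=> FM FQ prQ; have ltQM := proper_card prQ.
have [|Z [FZ sQZ sZ cZ]] := @augment_card #|M|.-1 Q M FQ FM.
  by rewrite leq_pred andbT -ltnS (ltn_predK ltQM).
have sZM : Z \subset M by move: sZ; rewrite (setUidPr (proper_sub prQ)).
have /properP[_ [b bM bZ]] : Z \proper M.
  by rewrite properEcard sZM cZ (ltn_predK ltQM) leqnn.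
exists b; first by rewrite inE bM andbT; apply: contra bZ; apply: (subsetP sQZ).
suff -> : M :\ b = Z by [].
apply/esym/eqP; rewrite eqEcard cZ (cardsD1 b M) bM leqnn andbT.
by rewrite subsetD1 sZM.
Qed.

(** * Paths, and why each of them is a chain *)

Lemma mem_xpath A x : A \in F -> x \in A ->
  [/\ xpath F A x \in F, x \in xpath F A x & xpath F A x \subset A].
Proof. by move=> FA xA; have /andP[sP /minsetP[/andP[]]] := xpathP FA xA. Qed.

(** Intersecting the path with [Q] stays feasible, so minimality upgrades to being least. *)
Lemma sub_xpath A Q x : A \in F -> Q \in F -> Q \subset A -> x \in Q ->
  xpath F A x \subset Q.
Proof.
move=> FA FQ sQA xQ; have xA := subsetP sQA _ xQ.
have /andP[sP /minsetP[/andP[FP xP] minP]] := xpathP FA xA.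
rewrite -(minP (xpath F A x :&: Q)) ?subsetIl ?subsetIr //=.
by rewrite (feasibleI FA) // inE xP.
Qed.

Lemma xpath_sub A B x : A \in F -> B \in F -> A \subset B -> x \in A ->
  xpath F A x = xpath F B x.
Proof.
move=> FA FB sAB xA; have /andP[sP mP] := xpathP FA xA.
apply: (is_xpath_uniq LI FB); last by apply/xpathP/(subsetP sAB).
by rewrite /is_xpath mP andbT (subset_trans sP).
Qed.

Lemma is_path_xpath A x : A \in F -> x \in A -> is_path F (xpath F A x).
Proof. by exists A, x. Qed.

(** Only the end [z] can be removed from a path. If [P :\ z] were not a path again, it would have
    two removable elements, which the local forest property forbids. The element [v] makes [P :\ z]
    nonempty. *)
Lemma path_pred P z v : P \in F -> xpath F P z = P -> z \in P -> v \in P ->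
    v != z ->
  P :\ z \in F /\ exists2 a, a \in P :\ z & xpath F (P :\ z) a = P :\ z.
Proof.
move=> FP eqzP zP vP vz.
have minP Q : Q \in F -> z \in Q -> Q \subset P -> Q = P.
  move=> FQ zQ sQ; apply/eqP; rewrite eqEsubset sQ /= -{1}eqzP.
  exact: sub_xpath.
have FM : P :\ z \in F.
  (* Some element is removable; removing any [b] other than [z] would contradict [minP]. *)
  have [|b] := removable_notin FP feasible0.
    by rewrite proper0; apply/set0Pn; exists z.
  rewrite inE => /andP[_ bP] FPb; have [<-//|bz] := eqVneq b z.
  have := minP _ FPb; rewrite !inE eq_sym bz zP subD1set => /(_ isT isT).
  by move/setP/(_ b); rewrite !inE eqxx bP.
split=> //; set M := P :\ z in FM *.
have [|a] := removable_notin FM feasible0.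
  by rewrite proper0; apply/set0Pn; exists v; rewrite !inE vz.
rewrite inE => /andP[_ aM] FMa; exists a => //.
have [FQ aQ sQ] := mem_xpath FM aM.
apply/eqP; rewrite eqEproper sQ /=; apply/negP=> prQ.
(* If the path of [a] is not all of [M], a second removable element exists outside it. *)
have [b] := removable_notin FM FQ prQ; rewrite inE => /andP[bQ bM] FMb.
have ab : a != b by apply: contraNneq bQ => <-.
have FX := feasibleI FM FMa FMb (subD1set _ _) (subD1set _ _).
set X := _ :&: _ in FX.
(* Here [X] is [P] without [a], [b] and [z]. Either alternative is a feasible subset of [P] that
   contains [z] and misses [a] or [b], against [minP]. *)
have [_ _ _ LF] := hF; move: (LF X a b z FX).
have [/andP[za aP] /andP[zb bP]] : (a != z) && (a \in P) /\ (b != z) && (b \in P).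
  by move: aM bM; rewrite !inE.
have eqbMa : a |: X = M :\ b.
  apply/setP=> u; rewrite !inE; have [->|_] := eqVneq u a; first by rewrite ab za.
  by case: (u == b); case: (u == z); case: (u \in P).
have eqaMb : b |: X = M :\ a.
  apply/setP=> u; rewrite !inE; have [->|_] := eqVneq u b.
    by rewrite eq_sym ab zb.
  by case: (u == a); case: (u == z); case: (u \in P).
have eqM : X :|: [set a; b] = M.
  apply/setP=> u; rewrite !inE; have [->|_] := eqVneq u a.
    by rewrite orbT za.
  have [->|_] := eqVneq u b; first by rewrite !orbT zb.
  by case: (u == z); case: (u \in P).
have eqabz : X :|: [set a; b; z] = P.
  by rewrite setUA eqM setUC setD1K.
rewrite eqbMa eqaMb eqM eqabz.
have contra c d : c \in P -> d != z -> d \in P -> c != z -> d != c ->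
    X :|: [set c; z] \in F -> d \notin X -> X :|: [set c; z] \subset P -> False.
  move=> cP dz dP cz dc FY dX sY.
  have /setP/(_ d) : X :|: [set c; z] = P by apply: minP; rewrite // !inE eqxx !orbT.
  by rewrite in_setU (negPf dX) in_set2 (negPf dz) (negPf dc) dP.
have sX : X \subset P.
  by apply/subsetP=> u; rewrite !inE => /andP[/andP[_ /andP[]]].
case=> // FY.
- apply: (contra a b) => //; first by rewrite eq_sym.
    by rewrite !inE eqxx andbF.
  by rewrite subUset sX subUset !sub1set aP.
- apply: (contra b a) => //; first by rewrite !inE eqxx.
  by rewrite subUset sX subUset !sub1set bP.
Qed.

(** Induction on the size of the path: if [u] and [v] both differ from the end [z], they lie in the
    shorter path [P :\ z]. *)
Lemma path_chain P z u v : P \in F -> z \in P -> xpath F P z = P ->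
  u \in P -> v \in P -> u \in xpath F P v \/ v \in xpath F P u.
Proof.
have [n] := ubnP #|P|; elim: n => // n IHn in P z *; rewrite ltnS => leP.
move=> FP zP eqzP uP vP.
have [->|uz] := eqVneq u z; first by right; rewrite eqzP.
have [->|vz] := eqVneq v z; first by left; rewrite eqzP.
have [FM [a aM eqM]] := path_pred FP eqzP zP vP vz.
rewrite -!(xpath_sub FM FP (subD1set _ _)) ?inE ?uz ?vz //.
apply: (IHn _ a) => //; try by rewrite !inE ?uz ?vz.
by move: leP; rewrite (cardsD1 z) zP.
Qed.

Lemma xpath_chain A z u v : A \in F -> z \in A ->
  u \in xpath F A z -> v \in xpath F A z ->
  u \in xpath F A v \/ v \in xpath F A u.
Proof.
move=> FA zA uP vP; have [FP zP sP] := mem_xpath FA zA.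
rewrite -(xpath_sub FP FA sP uP) -(xpath_sub FP FA sP vP).
by apply: (path_chain FP zP) => //; apply: xpath_sub.
Qed.

(** * Exchanging two elements that are parallel above [D] *)

Lemma parallel_swap D E x y : D \in F -> x |: D \in F -> y |: D \in F ->
    x |: (y |: D) \notin F -> E \in F -> y |: D \subset E -> x \notin D ->
    y \notin D ->
  x |: (E :\ y) \in F.
Proof.
move=> FD FxD FyD nF FE sE xD yD.
have yE : y \in E by apply: (subsetP sE); rewrite setU11.
(* Grow [x |: D] by elements of [E] to the size of [E]. If [y] entered, local union would make
   [x |: (y |: D)] feasible; so [y] stays out and counting identifies [Z]. *)
have [|Z [FZ sZ sZE cZ]] := @augment_card #|E| _ _ FxD FE.
  by rewrite leqnn andbT (leq_trans _ (subset_leq_card sE)) // !cardsU1 xD yD.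
have yZ : y \notin Z.
  apply: contra nF => yZ; have -> : x |: (y |: D) = (x |: D) :|: (y |: D).
    by rewrite setUA setUUl.
  apply: (feasibleU FZ) => //; rewrite subUset sub1set yZ.
  by apply: subset_trans sZ; rewrite subsetUr.
have sZ' : Z \subset x |: (E :\ y).
  apply/subsetP=> u uZ; have := subsetP sZE _ uZ; rewrite !inE.
  have -> : u != y by apply: contraNneq yZ => <-.
  case/orP=> [/orP[->//|uD]|->]; last by rewrite orbT.
  by rewrite (subsetP sE) ?orbT // !inE uD orbT.
suff <- : Z = x |: (E :\ y) by [].
apply/eqP; rewrite eqEcard sZ' cZ (cardsD1 y E) yE cardsU1.
by rewrite leq_add2r leq_b1.
Qed.

Section Parallel.
Variables (D : {set S}) (x y : S).
Hypotheses (FD : D \in F) (FxD : x |: D \in F) (FyD : y |: D \in F).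
Hypotheses (nF : x |: (y |: D) \notin F) (xD : x \notin D) (yD : y \notin D).

(** An element [u] of [D] on the path of [z] precedes [y]: otherwise the chain property puts [y] on
    the path of [u], which lies inside [D]. *)
Lemma xpath_through B z : B \in F -> y |: D \subset B -> z \in B ->
  y \in xpath F B z ->
  xpath F B z = xpath F B y :|: (xpath F B z :\: (y |: D)).
Proof.
move=> FB sB zB yP; have [FP zP sP] := mem_xpath FB zB.
have yB : y \in B by apply: (subsetP sP).
have [_ yPy _] := mem_xpath FB yB.
apply/eqP; rewrite eqEsubset; apply/andP; split; last first.
  by rewrite subUset subsetDl andbT sub_xpath.
apply/subsetP=> u uP; rewrite 2!inE uP andbT.
have [uD|] := boolP (u \in y |: D); last by rewrite orbT.
rewrite orbF; move: uD; rewrite !inE => /predU1P[->//|uD].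
have [//|yPu] := xpath_chain FB zB uP yP.
have sDB : D \subset B by apply: subset_trans sB; rewrite subsetUr.
by case/negP: yD; apply: (subsetP (sub_xpath FB FD sDB uD)).
Qed.

(** Swapping inside the smaller set [xpath F B z :|: D] gives a feasible set containing [z], which
    bounds the new path. *)
Lemma xpath_swap_sub B z : B \in F -> y |: D \subset B -> x \notin B ->
  z \in B -> y \in xpath F B z -> z != y ->
  xpath F (x |: B :\ y) z :\: (x |: D) \subset xpath F B z :\: (y |: D).
Proof.
move=> FB sB xB zB yP zy; have [FP zP sP] := mem_xpath FB zB.
have FB' := parallel_swap FD FxD FyD nF FB sB xD yD.
have sDB : D \subset B by apply: subset_trans sB; rewrite subsetUr.
have FE := feasibleU FB FP FD sP sDB.
set E := _ :|: D in FE.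
have FE' : x |: (E :\ y) \in F.
  apply: (parallel_swap FD) => //.
  by rewrite subUset sub1set inE yP subsetUr.
have sE' : x |: (E :\ y) \subset x |: B :\ y.
  by apply/setUS/setSD; rewrite subUset sP.
have := @sub_xpath _ _ z FB' FE' sE'; rewrite !inE zP zy orbT => /(_ isT) sQ.
apply/subsetP=> u; rewrite !inE !negb_or => /andP[/andP[ux uD] uQ].
have := subsetP sQ _ uQ; rewrite !inE (negPf ux) (negPf uD) orbF /=.
by case/andP=> -> ->.
Qed.

End Parallel.

Lemma xpath_swap D x y B z : D \in F -> x |: D \in F -> y |: D \in F ->
  x |: (y |: D) \notin F -> x \notin D -> y \notin D ->
  B \in F -> y |: D \subset B -> x \notin B -> z \in B -> z != y ->
  let B' := x |: B :\ y in
  xpath F B' z = xpath F B z \/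
  exists C, xpath F B z = xpath F B y :|: C /\
            xpath F B' z = xpath F B' x :|: C.
Proof.
move=> FD FxD FyD nF xD yD FB sB xB zB zy B'.
have yB : y \in B by apply: (subsetP sB); rewrite setU11.
have xy : x != y by apply: contraNneq xB => ->.
have FB' : B' \in F := parallel_swap FD FxD FyD nF FB sB xD yD.
have xB' : x \in B' by rewrite setU11.
have yB' : y \notin B' by rewrite !inE eqxx orbF eq_sym.
have zB' : z \in B' by rewrite !inE zB zy orbT.
(* The swap is undone by exchanging the roles of [x] and [y]; this yields the reverse inclusion of
   the tails at the end. *)
have eqB : y |: B' :\ x = B.
  apply/setP=> u; rewrite !inE; have [->|uy] := eqVneq u y; first by rewrite yB.
  by have [->|] := eqVneq u x; rewrite //= (negPf xB).
have [FP zP sP] := mem_xpath FB zB; have [FP' zP' sP'] := mem_xpath FB' zB'.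
(* A path avoiding [y] survives in [B']; likewise, below, one of [B'] avoiding [x] is already in
   [B]. *)
have [yP|yP] := boolP (y \in xpath F B z); last first.
  left; rewrite -(@xpath_sub (xpath F B z) B) //.
  rewrite (@xpath_sub _ B') //; apply/subsetP=> u uP; rewrite !inE.
  by rewrite (subsetP sP) // andbT; apply/orP; right; apply: contraNneq yP => <-.
have [xP'|xP'] := boolP (x \in xpath F B' z); last first.
  left; rewrite -(@xpath_sub (xpath F B' z) B') //.
  rewrite (@xpath_sub _ B) //; apply/subsetP=> u uP.
  have := subsetP sP' _ uP; rewrite !inE => /predU1P[eqx|/andP[]//].
  by rewrite -eqx uP in xP'.
have sxB' : x |: D \subset B'.
  rewrite setUS // subsetD1 yD andbT.
  by apply: subset_trans sB; rewrite subsetUr.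
have nF' : y |: (x |: D) \notin F by rewrite setUCA.
have zx : z != x by apply: contraNneq xB => <-.
right; exists (xpath F B z :\: (y |: D)); split; first exact: xpath_through.
rewrite {1}(xpath_through (D := D) (y := x)) //; congr (_ :|: _).
apply/eqP; rewrite eqEsubset xpath_swap_sub //=.
have := @xpath_swap_sub D y x FD FyD FxD nF' yD xD B' z.
by rewrite eqB; apply.
Qed.

End LocalForest.

(** * Optimality of the greedy choice *)

Section GreedyOptimal.
Variables (R : realType) (S : finType) (F : {set {set S}}) (f : {set S} -> R).
Hypothesis hF : local_forest_greedoid F.
Hypothesis hmono : forall A B : {set S}, is_path F A -> is_path F B ->
  A \subset B -> f A <= f B.
Hypothesis hunion : forall A B C : {set S}, is_path F A -> is_path F B ->
  is_path F (A :|: C) -> is_path F (B :|: C) ->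
  f A <= f B -> f (A :|: C) <= f (B :|: C).
Implicit Types (A B M : {set S}) (x y : S).

Let w := path_weight F f.

(** Old paths do not change as [A] grows, so the greedy rule compares only the values of the new
    paths. *)
Lemma path_weightU1 A x : A \in F -> x |: A \in F -> x \notin A ->
  w (x |: A) = f (xpath F (x |: A) x) + w A.
Proof.
move=> FA FxA xA; rewrite /w /path_weight big_setU1 //=; congr (_ + _).
by apply: eq_bigr => z zA; rewrite (xpath_sub hF FA FxA) ?subsetUr.
Qed.

Lemma greedy_le_later_path A B x y : A \in F -> B \in F -> A \subset B ->
  x \in continuations F A ->
  (forall u, u \in continuations F A -> w (x |: A) <= w (u |: A)) ->
  y \in B -> y \notin A ->
  f (xpath F (x |: A) x) <= f (xpath F B y).
Proof.
move=> FA FB sAB; rewrite !inE => /andP[xA FxA] xmin yB yA.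
have [FP yP sP] := mem_xpath FB yB.
have FU := feasibleU hF FB FA FP sAB sP.
(* The first step from [A] towards the path of [y] is a continuation [u] on that path; [x] costs no
   more than [u], and the path of [u] is contained in that of [y]. *)
have [|u] := augment hF FA FU.
  apply: proper_card; rewrite properE subsetUl /=; apply/subsetPn.
  by exists y; rewrite // inE yP orbT.
rewrite !inE; case: (boolP (u \in A)) => //= uA uP FuA.
have := xmin u; rewrite !inE uA FuA => /(_ isT).
rewrite !path_weightU1 // lerD2r => /le_trans; apply.
have suB : u |: A \subset B by rewrite subUset sub1set sAB (subsetP sP).
rewrite (xpath_sub hF FuA FB) ?setU11 //; apply: hmono.
- exact/is_path_xpath/(subsetP sP).
- exact: is_path_xpath.
- exact: sub_xpath.
Qed.

Lemma greedy_exchange A M x : A \in F -> is_minimum_base F w M ->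
  A \subset M -> x \in continuations F A ->
  (forall u, u \in continuations F A -> w (x |: A) <= w (u |: A)) ->
  exists2 M', is_minimum_base F w M' & x |: A \subset M'.
Proof.
move=> FA minM sAM xG xmin; have [[FM maxM] leM] := minM.
have [xM|xM] := boolP (x \in M).
  by exists M; rewrite // subUset sub1set xM.
have [xA FxA] : x \notin A /\ x |: A \in F.
  by move: xG; rewrite !inE => /andP[].
pose p := [pred D : {set S} | [&& A \subset D, D \subset M, D \in F & x |: D \in F]].
have pA : p A by rewrite /= subxx sAM FA.
have [D /= /and4P[sAD sDM FD FxD] maxD] := arg_maxnP (fun D : {set S} => #|D|) pA.
have xD : x \notin D by apply: contra xM; apply: (subsetP sDM).
(* [D] is smaller than [M] because [x |: D] is feasible and bases have maximum size. *)
have [|y] := augment hF FD FM.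
  by have := maxM _ FxD; rewrite cardsU1 xD.
rewrite inE => /andP[yD yM] FyD.
have sB : y |: D \subset M by rewrite subUset sub1set yM.
have nF : x |: (y |: D) \notin F.
  apply/negP=> FxyD; have := maxD (y |: D).
  rewrite /= sB FyD FxyD (subset_trans sAD) ?subsetUr // => /(_ isT).
  by rewrite /= cardsU1 yD ltnn.
have FM' := parallel_swap hF FD FxD FyD nF FM sB xD yD.
have yA : y \notin A by apply: contra yD; apply: (subsetP sAD).
have sM' : x |: A \subset x |: M :\ y by rewrite setUS // subsetD1 sAM yA.
have cM' : #|x |: M :\ y| = #|M|.
  by rewrite cardsU1 !inE (negPf xM) andbF (cardsD1 y M) yM.
exists (x |: M :\ y) => //; split.
  by split=> // E FE; rewrite cM' maxM.
move=> B' /leM; apply: le_trans.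
have lexy : f (xpath F (x |: M :\ y) x) <= f (xpath F M y).
  by rewrite -(xpath_sub hF FxA) ?setU11 //; apply: greedy_le_later_path.
rewrite /w /path_weight big_setU1 ?inE ?(negPf xM) ?andbF //=.
(* The term of [x] is matched with that of [y], every other term with itself. *)
rewrite (big_setD1 y yM) /=; apply: lerD => //; apply: ler_sum => z.
rewrite !inE => /andP[zy zM].
have zM' : z \in x |: M :\ y by rewrite !inE zy zM orbT.
have [->//|[C [eqM eqM']]] :=
  xpath_swap hF FD FxD FyD nF xD yD FM sB xM zM zy.
rewrite eqM eqM'; apply: hunion => //.
- by apply: is_path_xpath; rewrite ?setU11.
- exact: is_path_xpath.
- by rewrite -eqM'; apply: is_path_xpath.
- by rewrite -eqM; apply: is_path_xpath.
Qed.

Lemma minimum_base_exists : exists M, is_minimum_base F w M.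
Proof.
have F0 := feasible0 hF.
have [B0 FB0 maxB0] := arg_maxnP (fun D : {set S} => #|D|) F0.
pose b := [pred B : {set S} | (B \in F) && (#|B| == #|B0|)].
have baseE B : is_base F B -> b B.
  case=> FB maxB; rewrite /= FB eqn_leq maxB // andbT.
  exact: maxB0.
have b0 : b B0 by rewrite /= eqxx andbT.
have [M /andP[FM /eqP cM] minM] := arg_minP w b0.
exists M; split; last by move=> B' /baseE /minM.
by split=> // A FA; rewrite cM; apply: maxB0.
Qed.

Lemma greedy_invariant A s : path (greedy_step F w) A s ->
  A \in F -> (exists2 M, is_minimum_base F w M & A \subset M) ->
  last A s \in F /\
  exists2 M, is_minimum_base F w M & last A s \subset M.
Proof.
elim: s A => //= B s IHs A /andP[/existsP[x]].
case/and3P=> xG /forall_inP xmin /eqP-> pBs FA [M minM sAM].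
apply: IHs => //; first by move: xG; rewrite !inE => /andP[].
exact: greedy_exchange minM sAM xG xmin.
Qed.

Lemma greedy_output_minimum B : greedy_output F w B -> is_minimum_base F w B.
Proof.
case/andP=> /connectP[s ps ->] /eqP noG.
have [|FB [M minM sBM]] := greedy_invariant ps (feasible0 hF).
  by have [M minM] := minimum_base_exists; exists M; rewrite ?sub0set.
suff -> : last set0 s = M by [].
(* A final set smaller than [M] could still be augmented, so it would have a continuation. *)
apply/eqP; rewrite eqEcard sBM leqNgt; apply/negP=> ltB.
have [[FM _] _] := minM; have [y] := augment hF FB FM ltB.
rewrite inE => /andP[yB _] FyB.
by have := in_set0 y; rewrite -noG !inE yB FyB.
Qed.

End GreedyOptimal.

Theorem theorem16 (R : realType) (S : finType) (F : {set {set S}})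
    (f : {set S} -> R)
    (hF : local_forest_greedoid F)
    (hmono : forall A B : {set S}, is_path F A -> is_path F B ->
       A \subset B -> f A <= f B)
    (hunion : forall A B C : {set S}, is_path F A -> is_path F B ->
       is_path F (A :|: C) -> is_path F (B :|: C) ->
       f A <= f B -> f (A :|: C) <= f (B :|: C)) :
  forall B : {set S}, greedy_output F (path_weight F f) B ->
    is_minimum_base F (path_weight F f) B.
Proof. by move=> B; apply: greedy_output_minimum. Qed.
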